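(* Let $\ell=\ell(n)$ satisfy $3\log n\le\ell<n$, and let $G=(V,E)$ be an $n$-vertex graph in which every pair of vertices has at least $\ell$ common neighbours. Then $G$ admits a strong $d$-rigid partition for $d=\ell/(3\log n)$.
   Context: For $A,B\subseteq V$, $G[A,B]$ is the graph on $A\cup B$ with the edges of $G$ having one endpoint in $A$ and the other in $B$. A strong $d$-rigid partition of $G$ is a partition $V=V_1\cup\dots\cup V_d$ into nonempty sets such that $G[V_i,V_j]$ is connected for all $1\le i\le j\le d$. Logarithms are natural; the paper omits floor and ceiling signs, so $d$ is understood as rounded to an integer. *)

(* Defs.v *)
From mathcomp Require Import all_boot.

Set Implicit Arguments.
Unset Strict Implicit.
Unset Printing Implicit Defensive.

Definition simple_graph (T : finType) (e : rel T) : Prop :=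
  symmetric e /\ irreflexive e.

Definition common_neighbours (T : finType) (e : rel T) (u v : T) : {set T} :=
  [set w | e u w && e v w].

(* The edge relation of G[A, B]; for A = B it is that of the induced subgraph
   G[A]. *)
Definition between (T : finType) (e : rel T) (A B : {set T}) : rel T :=
  fun x y => e x y && ((x \in A) && (y \in B) || (x \in B) && (y \in A)).

(* Elements of T outside A :|: B are isolated for [between e A B], so paths
   between vertices of A :|: B never leave A :|: B. *)
Definition between_connected (T : finType) (e : rel T) (A B : {set T}) : Prop :=
  {in A :|: B &, forall x y, connect (between e A B) x y}.

Definition strong_rigid_partition (T : finType) (e : rel T) (d : nat)
    (V : 'I_d -> {set T}) : Prop :=
  [/\ \bigcup_(i < d) V i = [set: T],
      forall i j : 'I_d, i != j -> [disjoint V i & V j],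
      forall i : 'I_d, V i != set0
    & forall i j : 'I_d, i <= j -> between_connected e (V i) (V j)].

(* Main.v *)
Require Import Defs.
From mathcomp Require Import all_boot all_order all_algebra.
From mathcomp Require Import reals exp.
From mathcomp Require Import sequences lra.
Import Order.TTheory GRing.Theory Num.Theory.
Local Open Scope ring_scope.

(** Colour the vertices independently and uniformly with d colours.  A pair
    with k >= l common neighbours sees none of them in a given colour with
    probability (1 - 1/d)^k <= exp(-l/d) <= n^-3, so, as there are fewer than
    n^3 triples (u, v, colour), some colouring gives every pair of distinct
    vertices a common neighbour in every colour class.  The colour classes of
    such a colouring form a strong d-rigid partition: two vertices of V_i are
    joined through V_j in two steps, and a vertex of V_j has a neighbour in
    V_i. *)

(** The constraints at different points are independent, so these functions form a product
    [family F], with [d.-1] values allowed on [A] and [d] elsewhere. *)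
Lemma card_ffun_avoiding (T : finType) (d : nat) (A : {set T}) (i : 'I_d) :
  #|[set f : {ffun T -> 'I_d} | [forall w in A, f w != i]]|
  = (d.-1 ^ #|A| * d ^ #|~: A|)%N.
Proof.
pose F w : pred 'I_d := if w \in A then predC1 i else predT.
have -> : #|[set f : {ffun T -> 'I_d} | [forall w in A, f w != i]]|
          = #|family F|.
  apply: eq_card => f; rewrite inE; apply/forall_inP/familyP => h w.
    by rewrite /F; case: ifP => [/h|].
  by have := h w; rewrite /F => + wA; rewrite wA.
rewrite card_family foldrE big_map big_enum /= (bigID (mem A)) /=.
congr (_ * _)%N.
  rewrite -prod_nat_const; apply: eq_bigr => w wA.
  by rewrite /F wA cardC1 card_ord.
rewrite -prod_nat_const; apply: eq_big => [w|w /negbTE wA].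
  by rewrite !inE.
by rewrite /F wA card_ord.
Qed.

Lemma union_bound {I X : finType} (P : pred I) (B : I -> {set X}) :
  (\sum_(p | P p) #|B p| < #|X|)%N ->
  exists x, forall p, P p -> x \notin B p.
Proof.
move=> ltX; have leU : (#|\bigcup_(p | P p) B p| <= \sum_(p | P p) #|B p|)%N.
  elim/big_rec2: _ => [|p s U _ leU]; first by rewrite cards0.
  by rewrite (leq_trans (leq_card_setU _ _).1) ?leq_add2l.
have /set0Pn[x] : ~: (\bigcup_(p | P p) B p) != set0.
  by rewrite -card_gt0 cardsCs setCK subn_gt0 (leq_ltn_trans leU).
rewrite inE => xU; exists x => p Pp; apply: contra xU => xB.
by apply/bigcupP; exists p.
Qed.

(** Probabilities become counts: the second hypothesis is (1 - 1/d)^k <= n^-3 with denominators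
    cleared, for k = [#|N u v|] and n = [#|T|]. *)
Lemma exists_rainbow_colouring (T : finType) (d : nat) (N : T -> T -> {set T}) :
  (0 < d <= #|T|)%N ->
  (forall u v, u != v -> #|T| ^ 3 * d.-1 ^ #|N u v| <= d ^ #|N u v|)%N ->
  exists f : {ffun T -> 'I_d},
    forall u v i, u != v -> exists2 w, w \in N u v & f w = i.
Proof.
move=> /andP[d_gt0 d_le] leN.
have n_gt0 : (0 < #|T|)%N by exact: leq_trans d_le.
pose P (p : T * T * 'I_d) := p.1.1 != p.1.2.
pose B (p : T * T * 'I_d) :=
  [set f : {ffun T -> 'I_d} | [forall w in N p.1.1 p.1.2, f w != p.2]].
(* The strictness required by the union bound comes from here: [d <= #|T|] gives at most n^3
   triples, and [P] excludes the diagonal ones. *)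
have cardP : (#|P| < #|T| ^ 3)%N.
  have [t _] := card_gt0P n_gt0.
  apply: (@leq_trans #|{: T * T * 'I_d}|); last first.
    by rewrite !card_prod card_ord !expnS expn0 muln1 mulnA leq_mul2l d_le orbT.
  apply: (proper_card (B := predT)); apply/properP; split; first exact/subsetP.
  by exists (t, t, Ordinal d_gt0); rewrite // -topredE /= /P eqxx.
have sumB : (\sum_(p | P p) #|B p| < #|{ffun T -> 'I_d}|)%N.
  have n3_gt0 : (0 < #|T| ^ 3)%N by rewrite expn_gt0 n_gt0.
  (* After scaling by n^3, [leN] bounds each summand by [d ^ #|T|], without division. *)
  rewrite card_ffun card_ord -(ltn_pmul2l n3_gt0) big_distrr /=.
  apply: (@leq_ltn_trans (#|P| * d ^ #|T|)); last first.
    by rewrite ltn_pmul2r // expn_gt0 d_gt0.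
  rewrite -sum_nat_const; apply: leq_sum => -[[u v] i] uv.
  rewrite card_ffun_avoiding mulnA -[in leqRHS](cardsC (N u v)) expnD.
  by rewrite leq_mul2r leN ?orbT.
have [f fB] := union_bound _ _ sumB; exists f => u v i uv.
have := fB (u, v, i) uv; rewrite inE /= negb_forall_in => /exists_inP[w wN].
by rewrite negbK => /eqP fw; exists w.
Qed.

Lemma rainbow_strong_rigid (T : finType) (e : rel T) (d : nat)
    (f : {ffun T -> 'I_d}) :
  symmetric e -> (1 < #|T|)%N ->
  (forall u v i, u != v -> exists2 w, w \in common_neighbours e u v & f w = i) ->
  strong_rigid_partition e (fun i => [set w | f w == i]).
Proof.
move=> sym_e /card_gt1P[a [b [_ _ ab]]] fP; split.
- by apply/setP => x; rewrite inE; apply/bigcupP; exists (f x); rewrite ?inE.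
- move=> i j ij; rewrite disjoint_subset; apply/subsetP => x.
  by rewrite !inE => /eqP ->.
- by move=> i; have [w _ fw] := fP a b i ab; apply/set0Pn; exists w;
    rewrite inE fw.
move=> i j _; rewrite /between_connected; set E := between _ _ _.
have sym_E : connect_sym E.
  apply: sym_connect_sym => x y; rewrite /E /between sym_e; congr (_ && _).
  by rewrite orbC; congr (_ || _); apply: andbC.
have edgeP x y : e x y -> f x = i -> f y = j -> connect E x y.
  by move=> xy fx fy; apply: connect1; rewrite /E /between xy !inE fx fy !eqxx.
(* The middle vertex [w] has colour [j]; the case [i = j] needs no separate treatment. *)
have conn_i x y : f x = i -> f y = i -> connect E x y.
  move=> fx fy; have [->|xy] := eqVneq x y; first exact: connect0.
  have [w] := fP x y j xy; rewrite inE => /andP[xw yw] fw.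
  by apply: (@connect_trans _ _ w); [|rewrite sym_E]; apply: edgeP.
have to_i x : x \in [set w | f w == i] :|: [set w | f w == j] ->
    exists2 w, f w = i & connect E x w.
  rewrite !inE => /orP[/eqP fx|/eqP fx]; first by exists x.
  (* [fP] only speaks of distinct pairs, so [x] needs a partner; one of [a], [b] differs from it. *)
  have [y xy] : exists y, x != y.
    by have [<-|] := eqVneq a x; [exists b | exists a; rewrite eq_sym].
  have [w] := fP x y i xy; rewrite inE => /andP[xw _] fw.
  by exists w; rewrite // sym_E edgeP // sym_e.
move=> x y /to_i[w fw xw] /to_i[z fz yz].
by rewrite (connect_trans xw) // (connect_trans (conn_i _ _ fw fz)) // sym_E.
Qed.

Lemma expn_pred_le (R : realType) (n d k : nat) :
  (0 < n)%N -> (0 < d)%N -> d%:R * (3 * ln n%:R) <= k%:R :> R ->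
  (n ^ 3 * d.-1 ^ k <= d ^ k)%N.
Proof.
move=> n_gt0 d_gt0 dk.
have n0 : 0 < n%:R :> R by rewrite ltr0n.
have d0 : 0 < d%:R :> R by rewrite ltr0n.
rewrite -(ler_nat R) natrM !natrX.
(* This is 1 + x <= exp x at x = -1/d, multiplied by d. *)
have le1 : d.-1%:R <= d%:R * expR (- d%:R^-1) :> R.
  rewrite -subn1 natrB // -ler_pdivrMl // mulrBr mulVf ?gt_eqF // mulr1.
  exact: expR_ge1Dx.
(* With n = exp (ln n), the exponent is 3 ln n - k/d, which is at most 0. *)
have le2 : n%:R ^+ 3 * expR (- d%:R^-1) ^+ k <= 1 :> R.
  rewrite -{1}(lnK n0) -!expRM_natl -expRD expR_le1.
  by rewrite mulrN subr_le0 ler_pdivlMr // mulrC.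
apply: (@le_trans _ _ (n%:R ^+ 3 * (d%:R * expR (- d%:R^-1)) ^+ k)).
  by rewrite ler_wpM2l ?exprn_ge0 // lerXn2r // nnegrE // mulr_ge0 ?expR_ge0.
by rewrite exprMn mulrCA ler_piMr ?exprn_ge0.
Qed.

Theorem theorem5p1 (R : realType) (n : nat) (l : R) (T : finType) (e : rel T)
    (n_gt1 : (1 < n)%N)
    (l_ge : 3 * ln (n%:R : R) <= l) (l_lt : l < n%:R)
    (graph_e : simple_graph e) (card_T : #|T| = n)
    (common_e : forall u v : T,
        u != v -> l <= #|common_neighbours e u v|%:R) :
  exists V : 'I_(Num.truncn (l / (3 * ln (n%:R : R)))) -> {set T},
    strong_rigid_partition e V.
Proof.
have n_gt0 : (0 < n)%N by exact: ltnW.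
have n0 : 0 < n%:R :> R by rewrite ltr0n.
(* ln n >= 1 - 1/n >= 1/2 *)
have c_ge1 : 1 <= 3 * ln n%:R :> R.
  have := expR_ge1Dx (- ln n%:R : R); rewrite expRN lnK // => h.
  have : n%:R^-1 <= 2^-1 :> R by rewrite lef_pV2 ?posrE // ler_nat.
  by lra.
set c := 3 * ln _ in l_ge c_ge1 *; have c0 : 0 < c by apply: lt_le_trans c_ge1.
have l0 : 0 <= l by rewrite (le_trans (ltW c0)).
set d := Num.truncn _.
have d_le : d%:R <= l / c by rewrite truncn_le // divr_ge0 // ltW.
have d_gt0 : (0 < d)%N by rewrite truncn_gt0 ler_pdivlMr // mul1r.
(* Since c >= 1, d <= l/c <= l < n. *)
have d_len : (d <= #|T|)%N.
  rewrite card_T -(ler_nat R) (le_trans d_le) // ler_pdivrMr //.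
  by rewrite (le_trans (ltW l_lt)) // ler_peMr // ltW.
have [|u v uv|f fP] := @exists_rainbow_colouring T d (common_neighbours e).
- by rewrite d_gt0.
- rewrite card_T; apply: (@expn_pred_le R) => //.
  (* Rounding down gives d * c <= l, and l is at most the number of common neighbours. *)
  by rewrite (le_trans _ (common_e _ _ uv)) // -ler_pdivlMr.
- exists (fun i => [set w | f w == i]).
  by apply: rainbow_strong_rigid fP; [case: graph_e | rewrite card_T].
Qed.
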